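(* Let $G$ be a finite simple graph that is $(P_2\cup P_4)$-free and gem-free. Then $\chi(G)\le 3\omega(G)-2$.
   Context: $P_t$ denotes the path on $t$ vertices. For vertex-disjoint graphs $G_1,G_2$, $G_1\cup G_2$ is their disjoint union (no edges between them). A graph $G$ is $H$-free if no induced subgraph of $G$ is isomorphic to $H$. A gem is the graph obtained from a $P_4$ by adding a new vertex adjacent to all four vertices of the $P_4$. $\chi(G)$ is the chromatic number and $\omega(G)$ the clique number of $G$. *)

(* Defs.v *)
From mathcomp Require Import all_boot.
Set Implicit Arguments.
Unset Strict Implicit.
Unset Printing Implicit Defensive.

Record sgraph := SGraph {
  vertex :> finType;
  adj : rel vertex;
  adj_sym : symmetric adj;
  adj_irr : irreflexive adj }.

Arguments adj {s}.

Definition isomorphic (G H : sgraph) : Prop :=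
  exists2 f : G -> H, bijective f & forall x y, adj (f x) (f y) = adj x y.

Section Induced.
Variables (G : sgraph) (S : {set G}).

Definition induced_adj : rel {x : G | x \in S} :=
  fun x y => adj (val x) (val y).

Fact induced_sym : symmetric induced_adj.
Proof. by move=> x y; apply: adj_sym. Qed.

Fact induced_irr : irreflexive induced_adj.
Proof. by move=> x; apply: adj_irr. Qed.

Definition induced := SGraph induced_sym induced_irr.
End Induced.

Definition free (H G : sgraph) : Prop :=
  ~ exists S : {set G}, isomorphic (induced S) H.

Section Path.
Variable t : nat.

Definition path_adj : rel 'I_t := fun i j => (i.+1 == j) || (j.+1 == i).

Fact path_sym : symmetric path_adj.
Proof. by move=> i j; apply: orbC. Qed.

Fact path_irr : irreflexive path_adj.
Proof. by move=> i; rewrite /path_adj orbb eqn_leq ltnn. Qed.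

Definition path_graph := SGraph path_sym path_irr.
End Path.

Section DisjointUnion.
Variables G1 G2 : sgraph.

Definition union_adj : rel (G1 + G2) := fun u v =>
  match u, v with
  | inl x, inl y => adj x y
  | inr x, inr y => adj x y
  | _, _ => false
  end.

Fact union_sym : symmetric union_adj.
Proof. by move=> [x|x] [y|y] //=; apply: adj_sym. Qed.

Fact union_irr : irreflexive union_adj.
Proof. by move=> [x|x] /=; apply: adj_irr. Qed.

Definition disjoint_union := SGraph union_sym union_irr.
End DisjointUnion.

Section Cone.
Variable G : sgraph.

(* [None] is the added vertex, adjacent to every vertex of [G]. *)
Definition cone_adj : rel (option G) := fun u v =>
  match u, v with
  | Some x, Some y => adj x y
  | None, None => false
  | _, _ => true
  end.

Fact cone_sym : symmetric cone_adj.
Proof. by move=> [x|] [y|] //=; apply: adj_sym. Qed.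

Fact cone_irr : irreflexive cone_adj.
Proof. by move=> [x|] //=; apply: adj_irr. Qed.

Definition cone := SGraph cone_sym cone_irr.
End Cone.

Definition gem := cone (path_graph 4).

Section Invariants.
Variable G : sgraph.

Definition clique (S : {set G}) : bool :=
  [forall x in S, forall y in S, (x != y) ==> adj x y].

Definition omega : nat := \max_(S : {set G} | clique S) #|S|.

Definition proper_coloring k (f : {ffun G -> 'I_k}) : bool :=
  [forall x, forall y, adj x y ==> (f x != f y)].

Definition colorable k : bool :=
  [exists f : {ffun G -> 'I_k}, proper_coloring f].

Fact ex_colorable : exists k, colorable k.
Proof.
exists #|G|; apply/existsP; exists [ffun x => enum_rank x].
apply/forallP=> x; apply/forallP=> y; apply/implyP=> xy.
rewrite !ffunE (inj_eq enum_rank_inj).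
by apply: contraTneq xy => ->; rewrite adj_irr.
Qed.

Definition chi : nat := ex_minn ex_colorable.
End Invariants.

(* Main.v *)
Require Import Defs.
From mathcomp Require Import all_boot.
From mathcomp Require Import zify.

(** If [G] has an edge [uv], its vertices split into [N(u)], [N(v)] and the
    common non-neighbours of [u] and [v].  Each part induces a [P4]-free graph:
    the first two because [G] is gem-free, the third because [G] is
    [(P2 U P4)]-free.  A [P4]-free graph can be coloured with as many colours as
    its clique number, which is at most [omega - 1] in a neighbourhood, so
    [2 (omega - 1) + omega] colours suffice. *)

(** * Forbidden induced subgraphs *)

Lemma embedding_not_free (G H : sgraph) (h : H -> G) :
  injective h -> (forall x y, adj (h x) (h y) = adj x y) -> ~ free H G.
Proof.
move=> h_inj h_adj; apply; exists [set h x | x in H].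
have pre (y : induced [set h x | x in H]) : exists x, h x == val y.
  by have /imsetP[x _ ->] := valP y; exists x.
exists (fun y => xchoose (pre y)).
  have him x : h x \in [set h x | x in H] by apply: imset_f.
  exists (fun x => exist _ (h x) (him x)) => [y|x].
    by apply: val_inj => /=; apply/eqP/(xchooseP (pre y)).
  by apply: h_inj; apply/eqP/(xchooseP (pre (exist _ (h x) (him x)))).
by move=> y z; rewrite -h_adj (eqP (xchooseP (pre y))) (eqP (xchooseP (pre z))).
Qed.

(** Two vertices with the same image have the same neighbours, so they coincide when [H] has no
    twins. This spares comparing the images pairwise. *)
Lemma twin_free_morphism_inj (G H : sgraph) (h : H -> G) :
  (forall x y : H, (forall z, adj x z = adj y z) -> x = y) ->
  (forall x y, adj (h x) (h y) = adj x y) -> injective h.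
Proof. by move=> tf h_adj x y hxy; apply: tf => z; rewrite -!h_adj hxy. Qed.

(** The adjacency pattern already forces the four vertices to be distinct, because a [P4] has no
    twins. *)
Definition induced_P4 (G : sgraph) (a b c d : G) :=
  [/\ adj a b, adj b c & adj c d] /\ [/\ ~~ adj a c, ~~ adj a d & ~~ adj b d].

Definition P4_free_in (G : sgraph) (S : {set G}) :=
  forall a b c d, [/\ a \in S, b \in S, c \in S & d \in S] ->
  ~ induced_P4 G a b c d.

Definition four (T : Type) (a b c d : T) (i : 'I_4) : T :=
  match val i with 0 => a | 1 => b | 2 => c | _ => d end.

Lemma four_cases (P : 'I_4 -> Prop) :
  P (inord 0) -> P (inord 1) -> P (inord 2) -> P (inord 3) -> forall i, P i.
Proof.
move=> P0 P1 P2 P3 i; rewrite -(inord_val i).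
by case: i => [[|[|[|[|m]]]]].
Qed.

Lemma two_cases (P : 'I_2 -> Prop) :
  P (inord 0) -> P (inord 1) -> forall i, P i.
Proof.
by move=> P0 P1 i; rewrite -(inord_val i); case: i => [[|[|m]]].
Qed.

Lemma four_adj (G : sgraph) (a b c d : G) : induced_P4 G a b c d ->
  forall i j : path_graph 4,
  adj (four G a b c d i) (four G a b c d j) = adj i j.
Proof.
case=> -[ab bc cd] [/negbTE ac /negbTE ad /negbTE bd].
by do 2![elim/four_cases]; rewrite /four /= /path_adj !inordK //= ?adj_irr //
  ?ab ?bc ?cd ?ac ?ad ?bd // adj_sym ?ab ?bc ?cd ?ac ?ad ?bd.
Qed.

Lemma path4_twin_free (i j : path_graph 4) :
  (forall k, adj i k = adj j k) -> i = j.
Proof.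
move=> ij; have := (ij (inord 0), ij (inord 1), ij (inord 2), ij (inord 3)).
by move: i j {ij}; do 2![elim/four_cases];
  rewrite /= /path_adj !inordK //= => -[[[]]].
Qed.

Lemma path2_twin_free (i j : path_graph 2) :
  (forall k, adj i k = adj j k) -> i = j.
Proof.
move=> ij; have := (ij (inord 0), ij (inord 1)).
by move: i j {ij}; do 2![elim/two_cases];
  rewrite /= /path_adj !inordK //= => -[].
Qed.

(** An induced [P4] among the neighbours of [u] forms a gem with [u], which is sent to by the apex
    [None]. *)
Lemma gem_free_neighbourhood (G : sgraph) (u : G) :
  free gem G -> P4_free_in G [set x | adj u x].
Proof.
move=> gemF a b c d; rewrite !inE => -[ua ub uc ud] P4.
pose h (x : gem) := if x is Some i then four G a b c d i else u.
have uh i : adj u (four G a b c d i) by move: i; elim/four_cases;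
  rewrite /four /= inordK.
have h_adj x y : adj (h x) (h y) = adj x y.
  case: x y => [i|] [j|] /=; rewrite ?(four_adj _ _ _ _ _ P4) ?adj_irr ?uh //.
  by rewrite adj_sym uh.
apply: embedding_not_free gemF; [apply: twin_free_morphism_inj (h_adj)|exact: h_adj].
(* The apex and a path vertex [Some i] are told apart by [Some i] itself: the apex is adjacent to
   it, but it is not adjacent to itself. *)
move=> [i|] [j|] // ij.
- by rewrite (path4_twin_free i j) // => k; apply: ij (Some k).
- by have := ij (Some i); rewrite /= path_irr.
- by have := ij (Some j); rewrite /= path_irr.
Qed.

Lemma P2P4_free_non_neighbourhood (G : sgraph) (u v : G) :
  free (disjoint_union (path_graph 2) (path_graph 4)) G -> adj u v ->
  P4_free_in G [set x | ~~ adj u x && ~~ adj v x].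
Proof.
move=> PF uv a b c d; rewrite !inE => -[/andP[ua va] /andP[ub vb]].
move=> /andP[uc vc] /andP[ud vd] P4.
pose e (i : 'I_2) := if val i is 0 then u else v.
pose h (x : disjoint_union (path_graph 2) (path_graph 4)) :=
  match x with inl i => e i | inr i => four G a b c d i end.
have eh i j : adj (e i) (four G a b c d j) = false.
  by move: i j; elim/two_cases; elim/four_cases;
    rewrite /four /e /= !inordK //; apply/negbTE.
have ee (i j : path_graph 2) : adj (e i) (e j) = adj i j.
  by move: i j; do 2![elim/two_cases]; rewrite /e /= /path_adj !inordK //=
    ?adj_irr // adj_sym.
have h_adj x y : adj (h x) (h y) = adj x y.
  case: x y => [i|i] [j|j] /=; rewrite ?(four_adj _ _ _ _ _ P4) ?ee ?eh //.
  by rewrite adj_sym eh.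
apply: embedding_not_free PF; [apply: twin_free_morphism_inj (h_adj)|exact: h_adj].
(* A neighbour inside the [P2] separates each of its vertices from those of the [P4]. *)
have nb2 (i : path_graph 2) : exists k, adj i k.
  move: i; elim/two_cases; [exists (inord 1)|exists (inord 0)];
    by rewrite /= /path_adj !inordK.
move=> [i|i] [j|j] // ij.
- by rewrite (path2_twin_free i j) // => k; apply: ij (inl k).
- by have [k ik] := nb2 i; have := ij (inl k); rewrite [LHS]ik.
- by have [k jk] := nb2 j; have := ij (inl k); rewrite [RHS]jk.
- by rewrite (path4_twin_free i j) // => k; apply: ij (inr k).
Qed.

(** * Optimal colouring of [P4]-free sets *)

Definition stable (G : sgraph) (I : {set G}) :=
  [forall x in I, forall y in I, ~~ adj x y].

Lemma stableP (G : sgraph) (I : {set G}) :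
  reflect {in I &, forall x y, ~~ adj x y} (stable G I).
Proof.
apply: (iffP forall_inP) => [st x y xI yI|st x xI].
  by move/forall_inP: (st x xI); apply.
by apply/forall_inP => y yI; apply: st.
Qed.

Lemma cliqueP (G : sgraph) (K : {set G}) :
  reflect {in K &, forall x y, x != y -> adj x y} (clique K).
Proof.
apply: (iffP forall_inP) => [cl x y xK yK|cl x xK].
  by move/forall_inP: (cl x xK) => /(_ y yK) /implyP.
by apply/forall_inP => y yK; apply/implyP; apply: cl.
Qed.

Lemma cliqueU1 (G : sgraph) (v : G) (K : {set G}) :
  clique K -> {in K, forall x, adj v x} -> clique (v |: K).
Proof.
move=> /cliqueP clK vK; apply/cliqueP => x y /setU1P[->|xK] /setU1P[->|yK].
- by rewrite eqxx.
- by move=> _; apply: vK.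
- by move=> _; rewrite adj_sym; apply: vK.
- exact: clK.
Qed.

Lemma stableU1 (G : sgraph) (v : G) (I : {set G}) :
  stable G I -> {in I, forall x, ~~ adj v x} -> stable G (v |: I).
Proof.
move=> /stableP stI vI; apply/stableP => x y /setU1P[->|xI] /setU1P[->|yI].
- by rewrite adj_irr.
- exact: vI.
- by rewrite adj_sym; apply: vI.
- exact: stI.
Qed.

Lemma P4_free_stable_meets_clique (G : sgraph) (S I K : {set G}) :
  P4_free_in G S -> K != set0 ->
  maxset (fun A => stable G A && (A \subset S)) I ->
  maxset (fun A => clique A && (A \subset S)) K -> ~~ [disjoint I & K].
Proof.
move=> P4F /set0Pn[k0 k0K] /maxsetP[/andP[stI IS] maxI].
move=> /maxsetP[/andP[clK KS] maxK]; apply/negP => dIK.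
(* A vertex of [K] without a neighbour in [I] could be added to [I], hence would lie in both
   sets. *)
have nbr k : k \in K -> exists2 j, j \in I & adj k j.
  move=> kK; apply/exists_inP; apply: contraT => /exists_inPn knI.
  have kI : k \in I.
    rewrite -(maxI (k |: I)) ?setU11 ?subsetUr // stableU1 //=.
    by rewrite subUset sub1set (subsetP KS) // IS.
  by rewrite (disjointFr dIK kI) in kK.
(* Only the nonemptiness of [I] is extracted here, so that a maximum over [I] exists. *)
have [i0 i0I _] := nbr k0 k0K.
(* The vertex of [I] with most neighbours in [K] misses some [k] in [K]; a
   neighbour [j] of [k] in [I] then misses some [k'] adjacent to [i], and
   [i - k' - k - j] is an induced path. *)
case: (arg_maxnP (fun i => #|[set x in K | adj i x]|) i0I) => i iI imax.
(* Dually, by maximality of [K], a vertex of [I] adjacent to all of [K] would belong to [K]. *)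
have [k kK ik] : exists2 k, k \in K & ~~ adj i k.
  apply/exists_inP; apply: contraT => /exists_inPn iK.
  have iKin : i \in K.
    rewrite -(maxK (i |: K)) ?setU11 ?subsetUr // cliqueU1 //=.
      by rewrite subUset sub1set (subsetP IS) // KS.
    by move=> x /iK; rewrite negbK.
  by rewrite (disjointFr dIK iI) in iKin.
have [j jI kj] := nbr k kK.
(* Otherwise the choice of [i] makes the two neighbourhoods in [K] equal, yet [k] lies only in that
   of [j]. *)
have /subsetPn[k'] : ~~ ([set x in K | adj i x] \subset [set x in K | adj j x]).
  apply: contraNN ik => sub.
  have /eqP eqN : [set x in K | adj i x] == [set x in K | adj j x].
    by rewrite eqEcard sub; apply: imax.
  have : k \in [set x in K | adj j x] by rewrite inE kK adj_sym.
  by rewrite -eqN inE => /andP[].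
rewrite !inE => /andP[k'K ik']; rewrite k'K /= => jk'.
apply: (P4F i k' k j); first by split;
  [apply: (subsetP IS)|apply: (subsetP KS)|apply: (subsetP KS)|apply: (subsetP IS)].
split; split => //.
- by move/cliqueP: clK; apply => //; apply: contraTneq ik' => ->.
- by move/stableP: stI; apply.
- by rewrite adj_sym.
Qed.

(** Induction on [w]: a maximal stable set [I] of [S] receives the last colour, and removing it
    lowers the clique bound by one, since it meets every maximal clique. *)
Lemma P4_free_coloring (G : sgraph) (w : nat) (S : {set G}) :
  P4_free_in G S ->
  (forall K : {set G}, clique K -> K \subset S -> #|K| <= w) ->
  exists f : G -> nat, {in S, forall x, f x < w} /\
    {in S &, forall x y, adj x y -> f x != f y}.
Proof.
elim: w S => [|w IHw] S P4F wS.
  suff S0 : S = set0 by exists (fun _ => 0); split=> x; rewrite S0 inE.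
  apply/eqP; apply: contraT => /set0Pn[x xS].
  suff : #|[set x]| <= 0 by rewrite cards1.
  apply: wS; last by rewrite sub1set.
  by apply/cliqueP => y z /set1P-> /set1P->; rewrite eqxx.
have [|I maxI _] := @maxset_exists _ (fun A => stable G A && (A \subset S)) set0.
  by rewrite sub0set andbT; apply/stableP => x y; rewrite inE.
have /andP[/stableP stI IS] := maxsetp maxI.
have [||f [fw fP]] := IHw (S :\: I).
- move=> a b c d [/setDP[aS _] /setDP[bS _] /setDP[cS _] /setDP[dS _]].
  exact: P4F.
(* A clique with more than [w] vertices has the largest size allowed in [S], so it is
   inclusion-maximal and must meet [I]. *)
- move=> K clK; rewrite subsetD => /andP[KS dKI].
  rewrite leqNgt; apply/negP => wK.
  have K0 : K != set0 by rewrite -card_gt0; apply: leq_trans wK.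
  suff maxK : maxset (fun A => clique A && (A \subset S)) K.
    have := P4_free_stable_meets_clique G S I K P4F K0 maxI maxK.
    by rewrite disjoint_sym dKI.
  apply/maxsetP; split=> [|B /andP[clB BS] KB]; first by rewrite clK.
  by apply/esym/eqP; rewrite eqEcard KB (leq_trans (wS B clB BS)).
exists (fun x => if x \in I then w else f x); split=> [x xS|x y xS yS xy].
  by case: ifPn => // xI; apply/ltnW/fw; rewrite inE xI.
case: ifPn => xI; case: ifPn => yI.
- by rewrite (negbTE (stI x y xI yI)) in xy.
- by rewrite neq_ltn fw ?orbT // inE yI.
- by rewrite neq_ltn fw // inE xI.
- by apply: fP => //; rewrite inE ?xI ?yI.
Qed.

(** * Bounds on [omega] and [chi], and the final colouring *)

Lemma clique_leq_omega (G : sgraph) (K : {set G}) : clique K -> #|K| <= omega G.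
Proof. by move=> clK; rewrite /omega (bigD1 K) //= leq_maxl. Qed.

Lemma chi_leq (G : sgraph) (k : nat) (f : G -> nat) :
  (forall x, f x < k) -> (forall x y, adj x y -> f x != f y) -> chi G <= k.
Proof.
move=> fk fP; rewrite /chi; case: ex_minnP => m _; apply.
apply/existsP; exists [ffun x => Ordinal (fk x)].
apply/forallP => x; apply/forallP => y; apply/implyP => xy.
by rewrite !ffunE -val_eqE; apply: fP.
Qed.

(** Adding [u], which is not its own neighbour, gives a clique with one more vertex. *)
Lemma neighbourhood_clique (G : sgraph) (u : G) (K : {set G}) :
  clique K -> K \subset [set x | adj u x] -> #|K| <= (omega G).-1.
Proof.
move=> clK Ku; have uK : {in K, forall x, adj u x}.
  by move=> x /(subsetP Ku); rewrite inE.
have := clique_leq_omega G _ (cliqueU1 G u K clK uK).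
rewrite cardsU1; case: (boolP (u \in K)) => [/uK|_ /=]; last by lia.
by rewrite adj_irr.
Qed.

Theorem theorem1p1 (G : sgraph)
  (hP : free (disjoint_union (path_graph 2) (path_graph 4)) G)
  (hgem : free gem G) :
  chi G <= 3 * omega G - 2.
Proof.
have omega_gt0 (x : G) : 0 < omega G.
  rewrite -(cards1 x); apply: clique_leq_omega.
  by apply/cliqueP => y z /set1P-> /set1P->; rewrite eqxx.
have [/existsP[u /existsP[v uv]]|noE] := boolP [exists u : G, exists v, adj u v];
  last first.
  (* Without edges one colour suffices. Positivity of [omega G] is drawn from a vertex [x]; on the
     empty graph the truncated bound is 0 and the goals are vacuous. *)
  apply: (chi_leq G _ (fun _ => 0)) => [x|x y xy].
    by have := omega_gt0 x; lia.
  by case/existsP: noE; exists x; apply/existsP; exists y.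
have omega_gt1 : 0 < (omega G).-1.
  rewrite -(cards1 v); apply: (neighbourhood_clique G u); last by rewrite sub1set inE.
  by apply/cliqueP => y z /set1P-> /set1P->; rewrite eqxx.
have [f [fw fP]] := P4_free_coloring G _ _ (gem_free_neighbourhood G u hgem)
  (neighbourhood_clique G u).
have [g [gw gP]] := P4_free_coloring G _ _ (gem_free_neighbourhood G v hgem)
  (neighbourhood_clique G v).
have [h [hw hPr]] := P4_free_coloring G (omega G) _
  (P2P4_free_non_neighbourhood G u v hP uv)
  (fun K clK _ => clique_leq_omega G K clK).
pose w := (omega G).-1.
(* The offsets 0, [w] and [w + w] give the three parts disjoint palettes; common neighbours of [u]
   and [v] are coloured by [f]. An edge within a part is handled by that part's colouring, an edge
   between parts by disjointness. *)
apply: (chi_leq G _ (fun x => if adj u x then f x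
  else if adj v x then w + g x else w + w + h x)) => [x|x y xy].
  have := fw x; have := gw x; have := hw x; rewrite !inE /w.
  by case: (adj u x); case: (adj v x); lia.
have := (fw x, fw y, gw x, gw y); rewrite !inE => -[[[fx fy] gx] gy].
have := (fP x y, gP x y, hPr x y); rewrite !inE => -[[fxy gxy] hxy].
move: fx fy gx gy fxy gxy hxy; rewrite -/w.
by case: (adj u x); case: (adj u y); case: (adj v x); case: (adj v y) => /=;
  rewrite ?eqn_add2l; auto; lia.
Qed.
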